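(* Suppose $\mathcal U\neq\emptyset$, and the output constraint set $\mathcal C_y\subseteq\mathbb R^p$ imposes a bounded interval on some component $i\in\mathcal U$. Let $\mathbf D$ be any offline poisoned dataset generated by the true plant $(\bar A,\bar B,\bar C)$ with $(\bar A,\bar C_{\mathcal S})$ observable and any attack sequence $\mathbf a$. Assume that the given $T_{\mathsf p}$-step online sequence $(u^{[-T_{\mathsf p},-1]},y^{[-T_{\mathsf p},-1]})$ has terminal state $x^\star$ satisfying $\bar C_jx^\star\neq0$ for some $j\in\mathcal S$. Then there exists a minimal system $(A',B',C')\in\Sigma(\mathbf D)$ which leads to violation of the $i$th output constraint in online control operation. Consequently, no data-driven design rule based solely on $\mathbf D$ can guarantee the hard constraint on outputs in $\mathcal U$ uniformly over the consistency class $\Sigma(\mathbf D)$.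
   Context: A system $(A,B,C)$ with $A\in\mathbb R^{n\times n}$, $B\in\mathbb R^{n\times m}$, $C\in\mathbb R^{p\times n}$ denotes $x(k+1)=Ax(k)+Bu(k)$, $y(k)=Cx(k)$; it is minimal if $(A,B)$ is controllable and $(A,C)$ is observable. The true plant $(\bar A,\bar B,\bar C)$ is an (unknown) minimal system. Output indices $\{1,\dots,p\}$ are partitioned into protected indices $\mathcal S$ and unprotected indices $\mathcal U$. $C_i$ is the $i$th row of $C$, and $C_{\mathcal S}$, $C_{\mathcal U}$ are the submatrices of rows indexed by $\mathcal S$, $\mathcal U$ (similarly for subvectors). For a signal $v$, $v^{[i,j]}=\mathrm{col}(v(i),\dots,v(j))$. Offline poisoned dataset: $\mathbf D=(\mathbf u,\widetilde{\mathbf y})$ with $\widetilde{\mathbf y}(k)=\mathbf y(k)+\mathbf a(k)$, $k\in[0,N-1]$, where $(\mathbf u,\mathbf y)$ is an input-output trajectory of the true plant and $\mathbf a$ is an attack sequence, arbitrary except that $\mathbf a_\ell\equiv0$ for $\ell\in\mathcal S$. The set of systems consistent with $\mathbf D$ is $$\Sigma(\mathbf D)=\{(A,B,C):\ \exists\,\mathbf x_0,\ \exists\,\mathbf a\in\mathbb R^{pN}\text{ s.t. } \mathbf x(0)=\mathbf x_0,\ \mathbf x(k+1)=A\mathbf x(k)+B\mathbf u(k),\ \widetilde{\mathbf y}_{\mathcal S}(k)=C_{\mathcal S}\mathbf x(k),\ \widetilde{\mathbf y}_{\mathcal U}(k)=C_{\mathcal U}\mathbf x(k)+\mathbf a_{\mathcal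 U}(k),\ \forall k\in[0,N-1]\}.$$ Online control operation starts at time $k=0$ and is attack-free; at $k=0$ the past online measurements $(u^{[-T_{\mathsf p},-1]},y^{[-T_{\mathsf p},-1]})$ of the true plant are given, and their terminal state is the state $x^\star=x(0)$ reached at time $0$. The output constraint requires the online output $y(k)$ to lie in $\mathcal C_y$. A data-driven design rule is an arbitrary map from datasets $\mathbf D$ to controllers. *)

(* Defs.v *)
From HB Require Import structures.
From mathcomp Require Import all_boot all_order all_algebra.
From mathcomp Require Import classical_sets reals.

Set Implicit Arguments.
Unset Strict Implicit.
Unset Printing Implicit Defensive.

Import Order.TTheory GRing.Theory Num.Theory.
Local Open Scope ring_scope.

(* x(k+1) = A x(k) + B u(k),  y(k) = C x(k) *)
Record system (R : realType) (n m p : nat) := System {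
  sysA : 'M[R]_n;
  sysB : 'M[R]_(n, m);
  sysC : 'M[R]_(p, n) }.

Section Systems.
Variable R : realType.

(* M_Q: the rows of M indexed by Q, in increasing order; also used with q = 1
   for subvectors. *)
Definition rows (p q : nat) (Q : {set 'I_p}) (M : 'M[R]_(p, q)) :
    'M[R]_(#|Q|, q) :=
  rowsub (fun l : 'I_#|Q| => enum_val l) M.

(* The value of x at T is the terminal state; x is unconstrained after T. *)
Definition state_trajectory (n m : nat) (A : 'M[R]_n) (B : 'M[R]_(n, m))
    (T : nat) (u : 'I_T -> 'cV[R]_m) (x : nat -> 'cV[R]_n) : Prop :=
  forall k : 'I_T, x k.+1 = A *m x k + B *m u k.

Definition controllable (n m : nat) (A : 'M[R]_n) (B : 'M[R]_(n, m)) : Prop :=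
  forall x0 x1 : 'cV[R]_n,
    exists (T : nat) (u : 'I_T -> 'cV[R]_m) (x : nat -> 'cV[R]_n),
      [/\ state_trajectory A B u x, x 0%N = x0 & x T = x1].

Definition observable (n q : nat) (A : 'M[R]_n) (C : 'M[R]_(q, n)) : Prop :=
  forall x0 x1 : 'cV[R]_n,
    (forall k : nat, C *m iter k (mulmx A) x0 = C *m iter k (mulmx A) x1) ->
    x0 = x1.

Definition minimal (n m p : nat) (P : system R n m p) : Prop :=
  controllable (sysA P) (sysB P) /\ observable (sysA P) (sysC P).

Definition io_trajectory (n m p : nat) (P : system R n m p) (T : nat)
    (u : 'I_T -> 'cV[R]_m) (x : nat -> 'cV[R]_n) (y : 'I_T -> 'cV[R]_p) : Prop :=
  state_trajectory (sysA P) (sysB P) u x /\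
  forall k : 'I_T, y k = sysC P *m x k.

Record dataset (m p N : nat) := Dataset {
  data_u : 'I_N -> 'cV[R]_m;
  data_y : 'I_N -> 'cV[R]_p }.

Definition poisoned_dataset (n m p N : nat) (P : system R n m p)
    (S : {set 'I_p}) (D : dataset m p N) : Prop :=
  exists (x : nat -> 'cV[R]_n) (y a : 'I_N -> 'cV[R]_p),
    [/\ io_trajectory P (data_u D) x y,
        forall (k : 'I_N) (l : 'I_p), l \in S -> a k l 0 = 0 &
        forall k : 'I_N, data_y D k = y k + a k].

(* The consistency class Sigma(D), as the set of its members of order n. *)
Definition Sigma (n m p N : nat) (S U : {set 'I_p}) (D : dataset m p N) :
    set (system R n m p) :=
  fun P => exists (x : nat -> 'cV[R]_n) (a : 'I_N -> 'cV[R]_p),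
    [/\ state_trajectory (sysA P) (sysB P) (data_u D) x,
        forall k : 'I_N, rows S (data_y D k) = rows S (sysC P) *m x k &
        forall k : 'I_N,
          rows U (data_y D k) = rows U (sysC P) *m x k + rows U (a k)].

(* Past online sequences are indexed by 'I_Tp, index k standing for time
   k - Tp, so that the terminal state x(0) is the value at Tp. *)
Definition terminal_state (n m p Tp : nat) (P : system R n m p)
    (up : 'I_Tp -> 'cV[R]_m) (yp : 'I_Tp -> 'cV[R]_p) (xs : 'cV[R]_n) : Prop :=
  exists x : nat -> 'cV[R]_n, io_trajectory P up x yp /\ x Tp = xs.

(* The past sequence is produced by the true plant. Another member P of
   Sigma(D) shares with it the inputs and the protected outputs, and xs is an
   online initial state of P when these lead P to xs at time 0. This ties xs to
   the state coordinates of P: otherwise a mere change of coordinates of the true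
   plant, started from the untransformed xs, would count as a different plant. *)
Definition online_initial_state (n m p Tp : nat) (S : {set 'I_p})
    (P : system R n m p) (up : 'I_Tp -> 'cV[R]_m) (yp : 'I_Tp -> 'cV[R]_p)
    (xs : 'cV[R]_n) : Prop :=
  terminal_state (System (sysA P) (sysB P) (rows S (sysC P)))
                 up (fun k => rows S (yp k)) xs.

(* Attack-free operation on times k >= 0. *)
Definition online_run (n m p : nat) (P : system R n m p) (xs : 'cV[R]_n)
    (u : nat -> 'cV[R]_m) (x : nat -> 'cV[R]_n) (y : nat -> 'cV[R]_p) : Prop :=
  [/\ x 0%N = xs,
      forall k : nat, x k.+1 = sysA P *m x k + sysB P *m u k &
      forall k : nat, y k = sysC P *m x k].

(* Any bounded interval: each end may be open or closed. *)
Definition bounded_interval (I : interval R) : Prop :=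
  exists (bl br : bool) (lo hi : R), I = Interval (BSide bl lo) (BSide br hi).

Definition imposes (p : nat) (Cy : set 'cV[R]_p) (i : 'I_p) (I : interval R) :
    Prop :=
  forall y : 'cV[R]_p, Cy y -> y i 0 \in I.

(* P, brought to xs by the past sequence, violates the constraint "y_i in I"
   whatever inputs are applied from time 0 on. *)
Definition leads_to_violation (n m p Tp : nat) (S : {set 'I_p})
    (P : system R n m p) (up : 'I_Tp -> 'cV[R]_m) (yp : 'I_Tp -> 'cV[R]_p)
    (xs : 'cV[R]_n) (i : 'I_p) (I : interval R) : Prop :=
  online_initial_state S P up yp xs /\
  forall (u : nat -> 'cV[R]_m) (x : nat -> 'cV[R]_n) (y : nat -> 'cV[R]_p),
    online_run P xs u x y -> exists k : nat, y k i 0 \notin I.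

(* An arbitrary causal controller: u(k) as a function of the histories
   u^[-Tp,k-1] and y^[-Tp,k]. *)
Definition controller (m p : nat) : Type :=
  seq 'cV[R]_m -> seq 'cV[R]_p -> 'cV[R]_m.

Definition history (q Tp : nat) (vp : 'I_Tp -> 'cV[R]_q) (v : nat -> 'cV[R]_q)
    (k : nat) : seq 'cV[R]_q :=
  [seq vp t | t <- enum 'I_Tp] ++ mkseq v k.

Definition closed_loop_run (n m p Tp : nat) (P : system R n m p)
    (K : controller m p) (up : 'I_Tp -> 'cV[R]_m) (yp : 'I_Tp -> 'cV[R]_p)
    (xs : 'cV[R]_n)
    (u : nat -> 'cV[R]_m) (x : nat -> 'cV[R]_n) (y : nat -> 'cV[R]_p) : Prop :=
  online_run P xs u x y /\
  forall k : nat, u k = K (history up u k) (history yp y k.+1).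

Definition design_rule (m p N : nat) : Type := dataset m p N -> controller m p.

(* The constraint that "y in Cy" places on y_U. *)
Definition constraint_on (p : nat) (U : {set 'I_p}) (Cy : set 'cV[R]_p)
    (y : 'cV[R]_p) : Prop :=
  exists2 z : 'cV[R]_p, Cy z & rows U y = rows U z.

Definition uniform_guarantee (n m p N Tp : nat) (S U : {set 'I_p})
    (D : dataset m p N) (K : controller m p) (Cy : set 'cV[R]_p)
    (up : 'I_Tp -> 'cV[R]_m) (yp : 'I_Tp -> 'cV[R]_p) (xs : 'cV[R]_n) : Prop :=
  forall P : system R n m p, Sigma S U D P -> online_initial_state S P up yp xs ->
  forall (u : nat -> 'cV[R]_m) (x : nat -> 'cV[R]_n) (y : nat -> 'cV[R]_p),
    closed_loop_run P K up yp xs u x y ->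
    forall k : nat, constraint_on U Cy (y k).

End Systems.

(* Main.v *)
(* Sigma(D) and the past data constrain only the protected rows of C. Replacing
   row i of C by a multiple g of the protected row j, with g C_j x* outside the
   bounded interval, keeps controllability, and keeps observability because the
   protected rows already observe the state; the constraint fails at time 0,
   before any input can act on the output. *)
Require Import Defs.
From HB Require Import structures.
From mathcomp Require Import all_boot all_order all_algebra.
From mathcomp Require Import classical_sets reals.

Set Implicit Arguments.
Unset Strict Implicit.
Unset Printing Implicit Defensive.

Import Order.TTheory GRing.Theory Num.Theory.
Local Open Scope ring_scope.

Lemma bounded_interval_notin (R : realType) (I : interval R) :
  bounded_interval I -> exists v : R, v \notin I.
Proof.
(* A point strictly above [hi] is excluded whether the right end is open or closed. *)
move=> [bl [br [lo [hi ->]]]]; exists (hi + 1).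
rewrite in_itv negb_and; apply/orP; right.
by case: br => /=; rewrite -?ltNge -?leNgt ?ltrDl ?lerDl ?ltr01 ?ler01.
Qed.

Lemma rowsP (R : realType) (p q : nat) (Q : {set 'I_p}) (M M' : 'M[R]_(p, q)) :
  rows Q M = rows Q M' <-> (forall l c, l \in Q -> M l c = M' l c).
Proof.
split=> [eqM l c lQ | eqM].
  by have /matrixP/(_ (enum_rank_in lQ l) c) := eqM; rewrite !mxE enum_rankK_in.
by apply/matrixP=> r c; rewrite !mxE; apply: eqM; apply: enum_valP.
Qed.

Lemma rows_mulmx (R : realType) (p q r : nat) (Q : {set 'I_p})
    (M : 'M[R]_(p, q)) (M' : 'M[R]_(q, r)) :
  rows Q (M *m M') = rows Q M *m M'.
Proof. by rewrite /rows mul_rowsub_mx. Qed.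

Lemma observable_rows (R : realType) (n p : nat) (Q : {set 'I_p})
    (A : 'M[R]_n) (C : 'M[R]_(p, n)) :
  observable A (rows Q C) -> observable A C.
Proof. by move=> obs x0 x1 eqC; apply: obs => k; rewrite -!rows_mulmx eqC. Qed.

Definition replace_row (R : realType) (p q : nat) (C : 'M[R]_(p, q)) (i : 'I_p)
    (r : 'rV[R]_q) : 'M[R]_(p, q) :=
  \matrix_(l, c) if l == i then r 0 c else C l c.

Lemma row_replace_row (R : realType) (p q : nat) (C : 'M[R]_(p, q)) (i : 'I_p)
    (r : 'rV[R]_q) :
  row i (replace_row C i r) = r.
Proof. by apply/rowP=> c; rewrite !mxE eqxx. Qed.

Lemma rows_replace_row (R : realType) (p q : nat) (Q : {set 'I_p})
    (C : 'M[R]_(p, q)) (i : 'I_p) (r : 'rV[R]_q) :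
  i \notin Q -> rows Q (replace_row C i r) = rows Q C.
Proof.
move=> iQ; apply/rowsP=> l c lQ; rewrite mxE.
by case: eqP lQ iQ => // -> ->.
Qed.

(** The plant's own state trajectory serves as witness, and the attack, free on [U], absorbs the
    whole residual between the data and the outputs through [C]. On [S] the data are the true
    outputs, since the actual attack vanishes there. *)
Lemma Sigma_protected_rows (R : realType) (n m p N : nat) (S U : {set 'I_p})
    (plant : system R n m p) (D : dataset R m p N) (C : 'M[R]_(p, n)) :
  poisoned_dataset plant S D -> rows S C = rows S (sysC plant) ->
  Sigma S U D (System (sysA plant) (sysB plant) C).
Proof.
move=> [x [y [a [[tx ey] aS eD]]]] eqS.
exists x, (fun k => data_y D k - C *m x k); split=> //= k.
  rewrite eqS -rows_mulmx -ey eD.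
  by apply/rowsP=> l c lS; rewrite mxE (ord1 c) aS // addr0.
by rewrite -rows_mulmx; apply/matrixP=> l c; rewrite !mxE subrKC.
Qed.

(** A uniform guarantee quantifies over closed-loop runs, so refuting it takes an actual run. *)
Lemma closed_loop_run_exists (R : realType) (n m p Tp : nat)
    (P : system R n m p) (K : controller R m p)
    (up : 'I_Tp -> 'cV[R]_m) (yp : 'I_Tp -> 'cV[R]_p) (xs : 'cV[R]_n) :
  exists u x y, closed_loop_run P K up yp xs u x y.
Proof.
(* The recursion carries the histories along with the state. *)
pose out (s : 'cV[R]_n * (seq 'cV[R]_m * seq 'cV[R]_p)) := sysC P *m s.1.
(* The controller sees the current output. This creates no algebraic loop, because the output
   depends on the state alone. *)
pose inp s := K s.2.1 (rcons s.2.2 (out s)).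
pose step s := (sysA P *m s.1 + sysB P *m inp s,
                (rcons s.2.1 (inp s), rcons s.2.2 (out s))).
pose st k := iter k step
  (xs, ([seq up t | t <- enum 'I_Tp], [seq yp t | t <- enum 'I_Tp])).
pose u k := inp (st k); pose y k := out (st k).
have histS q (vp : 'I_Tp -> 'cV[R]_q) v k :
    history vp v k.+1 = rcons (history vp v k) (v k).
  by rewrite /history mkseqS rcons_cat.
have stE k : (st k).2 = (history up u k, history yp y k).
  elim: k => [|k IH]; first by rewrite /history !cats0.
  by rewrite !histS /= IH.
exists u, (fun k => (st k).1), y; split; first by split.
by move=> k; rewrite histS {1}/u /inp stE.
Qed.

Theorem proposition4 (R : realType) (n m p N Tp : nat)
    (S U : {set 'I_p}) (hSU : U = (~: S)%SET) (hU : U != finset.set0)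
    (Cy : set 'cV[R]_p) (i : 'I_p) (hi : i \in U)
    (I : interval R) (hI : bounded_interval I) (hCy : imposes Cy i I)
    (plant : system R n m p) (hmin : minimal plant)
    (hobs : observable (sysA plant) (rows S (sysC plant)))
    (D : dataset R m p N) (hD : poisoned_dataset plant S D)
    (up : 'I_Tp -> 'cV[R]_m) (yp : 'I_Tp -> 'cV[R]_p) (xstar : 'cV[R]_n)
    (hpast : terminal_state plant up yp xstar)
    (hx : exists2 j : 'I_p, j \in S & row j (sysC plant) *m xstar != 0) :
  (exists P' : system R n m p,
     [/\ minimal P', Sigma S U D P' &
         leads_to_violation S P' up yp xstar i I]) /\
  (forall rule : design_rule R m p N,
     ~ uniform_guarantee S U D (rule D) Cy up yp xstar).
Proof.
have [j jS Cjx] := hx; have [v vI] := bounded_interval_notin hI.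
have iS : i \notin S by move: hi; rewrite hSU inE.
set z := row j (sysC plant) *m xstar in Cjx.
have z0 : z 0 0 != 0.
  apply: contra_neq Cjx => z0; apply/matrixP=> a b.
  by rewrite (ord1 a) (ord1 b) z0 mxE.
(* The gain is chosen so that the new row [i] sends [xstar] exactly to [v], a value outside [I]. *)
pose C' := replace_row (sysC plant) i ((v / z 0 0) *: row j (sysC plant)).
pose P' := System (sysA plant) (sysB plant) C'.
have C'S : rows S C' = rows S (sysC plant) by apply: rows_replace_row.
have C'x : (C' *m xstar) i 0 = v.
  have -> : (C' *m xstar) i 0 = (row i C' *m xstar) 0 0 by rewrite -row_mul [RHS]mxE.
  by rewrite row_replace_row -scalemxAl mxE divfK.
have minP' : minimal P'.
  split; first exact: hmin.1.
  by apply: (@observable_rows _ _ _ S); rewrite /= C'S.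
have SigP' : Sigma S U D P' by apply: Sigma_protected_rows.
have initP' : online_initial_state S P' up yp xstar.
  (* The plant's past states also fit [P'], which shares its dynamics and its protected rows. *)
  case: hpast => x [[tx ey] xT]; exists x; split=> //; split=> //= k.
  by rewrite C'S -rows_mulmx ey.
have y0 u x y : online_run P' xstar u x y -> y 0%N i 0 = v.
  by case=> x0 _ ey; rewrite ey x0.
split=> [|rule guar].
  exists P'; split=> //; split=> // u x y run.
  by exists 0%N; rewrite (y0 _ _ _ run).
have [u [x [y run]]] := closed_loop_run_exists P' (rule D) up yp xstar.
(* The point [w] of [Cy] agrees with [y 0] on [U], hence at [i], where its entry would be [v]. *)
have [w Cw /rowsP eqw] := guar P' SigP' initP' u x y run 0%N.
by move: vI; rewrite -(y0 _ _ _ run.1) eqw // (hCy _ Cw).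
Qed.
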